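(* In the setting of the context, assume $\mathcal J[1]\supseteq Q$. Then $\mathrm n_-\big(I_{\{P,Q\}}|_{\mathcal H_{\{P,Q\}}\times\mathcal H_{\{P,Q\}}}\big)=\mathrm n_-\big(I|_{\mathcal H_P(1)\times\mathcal H_P(1)}\big)+\mathrm n_-\big(F|_{\mathcal J_Q\times\mathcal J_Q}\big).$
   Context: Fix a nondegenerate symmetric bilinear form $g$ on $\mathbb R^n$ of index $1$, a continuous map $R:[0,1]\to\mathcal L(\mathbb R^n)$ with each $R(t)$ $g$-symmetric, a $C^2$ map $Y:[0,1]\to\mathbb R^n$ with $g(Y,Y)<0$ and $Y''=R(t)[Y]$, a $g$-nondegenerate subspace $P\subset\mathbb R^n$ with a $g$-symmetric linear map $S^P:P\to P$, and a subspace $Q\subset\mathbb R^n$ with a $g$-symmetric linear map $S^Q:Q\to Q$; $\perp$ denotes $g$-orthogonality. A Jacobi field is a solution of $V''=R(t)[V]$ on $[0,1]$; it is a $P$-Jacobi field if $V(0)\in P$ and $V'(0)+S^P[V(0)]\in P^\perp$; for a Jacobi field $J$ the quantity $C_J=g(J',Y)-g(J,Y')$ is constant. $H^1_{\{P,Q\}}$ is the space of $V\in H^1([0,1];\mathbb R^n)$ with $V(0)\in P$, $V(1)\in Q$, and $I_{\{P,Q\}}(V,W)=\int_0^1[g(V',W')+g(R(t)[V],W)]dt+g(S^Q[V(1)],W(1))-g(S^P[V(0)],W(0))$ on it. $\mathcal H_{\{P,Q\}}=\{V\in H^1_{\{P,Q\}}: g(V',Y)-g(V,Y')=0\text{ a.e.}\}$.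 $H^1_P([0,1];\mathbb R^n)=\{V\in H^1: V(0)\in P, V(1)=0\}$, $I$ is the restriction of $I_{\{P,Q\}}$ to it, and $\mathcal H_P(1)=\{V\in H^1_P: g(V',Y)-g(V,Y')=0\text{ a.e.}\}$. $\mathcal J^*_Q$ is the space of $P$-Jacobi fields $J$ with $J(1)\in Q$, $\mathcal J_Q=\{J\in\mathcal J^*_Q: C_J=0\}$, $F$ is the restriction of $I_{\{P,Q\}}$ to $\mathcal J^*_Q\times\mathcal J^*_Q$ (equivalently $F(J_1,J_2)=g(S^Q[J_1(1)],J_2(1))+g(J_1'(1),J_2(1))$), and $\mathcal J[1]=\{J(1): J\text{ a }P\text{-Jacobi field with }C_J=0\}$. $\mathrm n_-$ denotes the index (maximal dimension of a negative definite subspace). *)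

(* Defs.v *)
From HB Require Import structures.
From mathcomp Require Import all_boot all_order all_algebra.
From mathcomp Require Import all_classical all_reals all_analysis.
Set Implicit Arguments. Unset Strict Implicit. Unset Printing Implicit Defensive.
Import Order.TTheory GRing.Theory Num.Theory.
Import numFieldNormedType.Exports.
Local Open Scope classical_set_scope.
Local Open Scope ring_scope.

(* Vectors of R^n are row vectors 'rV[R]_n; a linear map A acts on the right:
   A[v] := v *m A.  Subspaces of R^n are row spaces of matrices (v <= P)%MS. *)

Section Defs.
Variable R : realType.

Definition gform n (G : 'M[R]_n) (v w : 'rV[R]_n) : R := (v *m G *m w^T) 0 0.

(* index n_-(B|_S): sup of dimensions of subspaces W (spanned by k vectors
   f_0..f_{k-1}) contained in S on which B is negative definite.  *)
Definition neg_index (V : lmodType R) (S : set V) (B : V -> V -> R) : \bar R :=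
  ereal_sup [set (k%:R)%:E | k in [set k : nat | exists f : 'I_k -> V,
     (forall c : 'I_k -> R, S (\sum_i c i *: f i)) /\
     (forall c : 'I_k -> R, (exists i, c i != 0) ->
        B (\sum_i c i *: f i) (\sum_i c i *: f i) < 0)]].

Definition gperp n (G : 'M[R]_n) (P : 'M[R]_n) (w : 'rV[R]_n) : Prop :=
  forall v, (v <= P)%MS -> gform G w v = 0.

Definition I01 : set R := `[0%R, 1%R].

(* An element of H^1([0,1];R^n) is represented by a pair (V, W) where W is
   (a representative of) the weak derivative V' : W is square integrable on
   [0,1] and V t = V 0 + \int_0^t W for t in [0,1] (componentwise). *)
Definition HT n := ((R -> 'rV[R]_n) * (R -> 'rV[R]_n))%type.

Definition H1 n (x : HT n) : Prop :=
  (forall i, (@lebesgue_measure R).-integrable I01 (fun s => (x.2 s 0 i)%:E)) /\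
  (forall i, (@lebesgue_measure R).-integrable I01 (fun s => ((x.2 s 0 i) ^+ 2)%:E)) /\
  (forall t, I01 t -> forall i,
      x.1 t 0 i = x.1 0 0 i + Rintegral (@lebesgue_measure R) `[0%R, t] (fun s => x.2 s 0 i)).

Definition Iform n (G : 'M[R]_n) (Rm : R -> 'M[R]_n) (SP SQ : 'M[R]_n)
  (x y : HT n) : R :=
  Rintegral (@lebesgue_measure R) I01
    (fun t => gform G (x.2 t) (y.2 t) + gform G (x.1 t *m Rm t) (y.1 t))
  + gform G (x.1 1 *m SQ) (y.1 1) - gform G (x.1 0 *m SP) (y.1 0).

Definition jacobi n (Rm : R -> 'M[R]_n) (J dJ : R -> 'rV[R]_n) : Prop :=
  (forall t : R, is_derive t (1 : R) J (dJ t)) /\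
  exists ddJ : R -> 'rV[R]_n, (forall t : R, is_derive t (1 : R) dJ (ddJ t)) /\
     (forall t, I01 t -> ddJ t = J t *m Rm t).

Definition PJacobi n (G : 'M[R]_n) (Rm : R -> 'M[R]_n) (P SP : 'M[R]_n)
  (J dJ : R -> 'rV[R]_n) : Prop :=
  jacobi Rm J dJ /\ (J 0 <= P)%MS /\ gperp G P (dJ 0 + J 0 *m SP).

Definition CJ0 n (G : 'M[R]_n) (Y dY J dJ : R -> 'rV[R]_n) : Prop :=
  forall t, I01 t -> gform G (dJ t) (Y t) - gform G (J t) (dY t) = 0.

Definition JstarQ n G Rm (P SP Q : 'M[R]_n) : set (HT n) :=
  [set x | PJacobi G Rm P SP x.1 x.2 /\ (x.1 1 <= Q)%MS].

Definition JQ n G Rm (P SP Q : 'M[R]_n) (Y dY : R -> 'rV[R]_n) : set (HT n) :=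
  [set x | JstarQ G Rm P SP Q x /\ CJ0 G Y dY x.1 x.2].

Definition H1PQ n (P Q : 'M[R]_n) : set (HT n) :=
  [set x | H1 x /\ (x.1 0 <= P)%MS /\ (x.1 1 <= Q)%MS].

Definition HcalPQ n (G P Q : 'M[R]_n) (Y dY : R -> 'rV[R]_n) : set (HT n) :=
  [set x | H1PQ P Q x /\
     {ae @lebesgue_measure R, forall t, I01 t ->
        gform G (x.2 t) (Y t) - gform G (x.1 t) (dY t) = 0}].

Definition H1P n (P : 'M[R]_n) : set (HT n) :=
  [set x | H1 x /\ (x.1 0 <= P)%MS /\ x.1 1 = 0].

Definition HP1 n (G P : 'M[R]_n) (Y dY : R -> 'rV[R]_n) : set (HT n) :=
  [set x | H1P P x /\
     {ae @lebesgue_measure R, forall t, I01 t ->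
        gform G (x.2 t) (Y t) - gform G (x.1 t) (dY t) = 0}].

End Defs.

(* Main.v *)
Require Import Defs.
From HB Require Import structures.
From mathcomp Require Import all_boot all_order all_algebra.
From mathcomp Require Import all_classical all_reals all_analysis.
From mathcomp Require Import measurable_realfun.
From mathcomp Require Import ring lra.
Import Order.TTheory GRing.Theory Num.Theory.
Import numFieldNormedType.Exports.
Local Open Scope classical_set_scope.
Local Open Scope ring_scope.

(* Since J[1] contains Q, every V in H_{P,Q} differs from some J in J_Q by an element
   of H_P(1).  Integration by parts gives I_{P,Q}(V, J) = 0 for V in H_P(1) and J in
   J_Q: the integral vanishes by the Jacobi equation, the boundary term at 1 because
   V(1) = 0, and the one at 0 because J is a P-Jacobi field.  So H_{P,Q} is an
   I_{P,Q}-orthogonal, not necessarily direct, sum H_P(1) + J_Q, and the index is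
   additive on such sums. *)

(** * Matrix bilinear forms and the splitting of a symmetric form by sign *)

Section gform_theory.
Context {R : realType} {n : nat} (G : 'M[R]_n).
Implicit Types (a : R) (u v w : 'rV[R]_n).

Lemma gformPl a u v w : gform G (a *: u + v) w = a * gform G u w + gform G v w.
Proof. by rewrite /gform !mulmxDl -!scalemxAl !mxE. Qed.

Lemma gform0l w : gform G 0 w = 0.
Proof. by rewrite /gform !mul0mx mxE. Qed.

Lemma gformE v w : gform G v w = \sum_i (v *m G) 0 i * w 0 i.
Proof. by rewrite /gform mxE; apply: eq_bigr => i _; rewrite !mxE. Qed.

Lemma gformC v w : G^T = G -> gform G v w = gform G w v.
Proof.
by move=> Gsym; rewrite /gform -[in LHS](trmxK (v *m G *m w^T)) mxE !trmx_mul trmxK Gsym mulmxA.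
Qed.

Lemma gformDl u v w : gform G (u + v) w = gform G u w + gform G v w.
Proof. by rewrite -[u]scale1r gformPl mul1r scale1r. Qed.

End gform_theory.

(* [N] is a negative definite subspace of maximal dimension and [Z] its
   [F]-orthogonal complement. *)
Lemma symmetric_form_split {R : realType} {k : nat} (F : 'M[R]_k) : F^T = F ->
  exists b m (N : 'M[R]_(b, k)) (Z : 'M[R]_(m, k)),
  [/\ (k <= b + m)%N, row_free Z,
      forall c, c != 0 -> gform F (c *m N) (c *m N) < 0 &
      forall c, 0 <= gform F (c *m Z) (c *m Z)].
Proof.
move=> Fsym.
pose nd b (N : 'M[R]_(b, k)) := forall c, c != 0 -> gform F (c *m N) (c *m N) < 0.
pose p b := `[< exists N, nd b N >].
have p0 : p 0.
  by apply/asboolP; exists 0 => c; rewrite thinmx0 eqxx.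
have pk b : p b -> (b <= k)%N.
  move=> /asboolP[N Nneg].
  (* A combination killed by [N] has form value 0, so it is trivial; this bounds [b] by [k] and lets
     a maximal [b] be chosen. *)
  have : row_free N.
    apply: inj_row_free => c cN0; apply/eqP; apply: contraT => /Nneg.
    by rewrite cN0 gform0l ltxx.
  by move=> /eqP <-; exact: rank_leq_col.
case: (ex_maxnP (ex_intro (fun b => is_true (p b)) 0%N p0) pk) => b /asboolP[N Nneg] bmax.
pose K := kermx (F *m N^T).
exists b, (\rank K), N, (row_base K); split => //.
(* [F *m N^T] has only [b] columns, so its kernel has dimension at least [k - b]. *)
- rewrite -leq_subLR mxrank_ker leq_sub2l //.
  by apply: leq_trans (rank_leq_col _) _.
- exact: row_base_free.
move=> c; set z := c *m row_base K.
rewrite leNgt; apply/negP => zneg.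
have zN : z *m F *m N^T = 0.
  have : (z <= K)%MS by apply: submx_trans (submxMl _ _) _; rewrite eq_row_base.
  by rewrite -mulmxA => /sub_kermxP.
(* Appending to [N] the negative vector [z], which is [F]-orthogonal to the rows of [N], would
   contradict the maximality of [b]. *)
suff : p (b + 1)%N by move=> /bmax; rewrite addn1 ltnn.
apply/asboolP; exists (col_mx N z) => d.
rewrite -[d]hsubmxK mul_row_col; set x := lsubmx d; set y := rsubmx d => d0.
have yE : y *m z = y 0 0 *: z.
  by apply/rowP => j; rewrite mxE [in RHS]mxE big_ord1.
have zxN : gform F z (x *m N) = 0.
  by rewrite /gform trmx_mul mulmxA zN mul0mx mxE.
rewrite yE addrC gformPl (gformC _ _ _ Fsym) gformPl.
rewrite [gform F (x *m N) (_ + _)](gformC _ _ _ Fsym) gformPl.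
rewrite [gform F (x *m N) z](gformC _ _ _ Fsym) zxN.
rewrite !mulr0 add0r addr0 mulrA -expr2.
(* The value is now [y^2 F(z, z) + F(xN, xN)]: for nonzero [x] the second summand is negative,
   otherwise [y] is nonzero and the first one is. *)
have [x0|x0] := eqVneq x 0; last first.
  by rewrite -[ltRHS]addr0; apply: ler_ltD (Nneg _ x0); rewrite nmulr_lle0// sqr_ge0.
rewrite x0 mul0mx gform0l addr0 nmulr_llt0// exprn_even_gt0//=.
move: d0; apply: contra_neq => y0; rewrite x0 -[RHS]row_mx0; congr row_mx.
by apply/matrixP => i j; rewrite !ord1 [RHS]mxE.
Qed.

(** * Additivity of the index over orthogonal sums *)

Section neg_index_orthogonal.
Context {R : realType} {V : lmodType R}.
Implicit Types (S : set V) (B : V -> V -> R).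

Definition linear_subspace S :=
  S 0 /\ forall a x y, S x -> S y -> S (a *: x + y).

Lemma linear_subspace_sum S k (c : 'I_k -> R) (f : 'I_k -> V) :
  linear_subspace S -> (forall i, S (f i)) -> S (\sum_i c i *: f i).
Proof.
move=> [S0 SD] Sf; elim/big_ind : _ => // [x y Sx Sy|i _].
  by rewrite -[x]scale1r; exact: SD.
by rewrite -[X in S X]addr0; exact: SD.
Qed.

(** Delta coefficients turn the condition on all combinations in [neg_index] into membership of each
    single [f i]. *)
Lemma sum_delta k (f : 'I_k -> V) i : \sum_j (j == i)%:R *: f j = f i.
Proof.
rewrite (bigD1 i)//= eqxx scale1r big1 ?addr0// => j /negbTE ->.
by rewrite scale0r.
Qed.

Lemma neg_index_ge0 S B : S 0 -> (0 <= neg_index S B)%E.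
Proof.
move=> S0; apply: ereal_sup_ubound; exists 0%N => //.
by exists (fun=> 0); split => [c|c [[]]//]; rewrite big_ord0.
Qed.

Context (S : set V) (B : V -> V -> R).
Hypothesis subS : linear_subspace S.
Hypothesis BPl : forall a x y z, S x -> S y -> S z ->
  B (a *: x + y) z = a * B x z + B y z.
Hypothesis BC : forall x y, S x -> S y -> B x y = B y x.

Lemma bilinear_suml k (c : 'I_k -> R) (f : 'I_k -> V) z :
  (forall i, S (f i)) -> S z -> B (\sum_i c i *: f i) z = \sum_i c i * B (f i) z.
Proof.
move=> Sf Sz.
have B0z : B 0 z = 0.
  (* This instance reads [B 0 z = B 0 z + B 0 z]. *)
  have := BPl 1 0 0 z subS.1 subS.1 Sz.
  by rewrite scale1r addr0 mul1r => /eqP; rewrite -subr_eq0 opprD addNKr oppr_eq0 => /eqP.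
elim: k c f Sf => [|k IH] c f Sf; first by rewrite !big_ord0.
rewrite !big_ord_recl BPl ?IH//.
exact: linear_subspace_sum.
Qed.

(** The Gram matrix carries a sign question about [B] on a spanned space to coefficient vectors,
    where [symmetric_form_split] applies. *)
Lemma bilinear_sum k (c : 'I_k -> R) (f : 'I_k -> V) : (forall i, S (f i)) ->
  B (\sum_i c i *: f i) (\sum_i c i *: f i) =
  gform (\matrix_(i, j) B (f i) (f j)) (\row_i c i) (\row_i c i).
Proof.
move=> Sf; have Ss := linear_subspace_sum S k c f subS Sf.
rewrite bilinear_suml// gformE [RHS](eq_bigr (fun j => \sum_i c i * B (f i) (f j) * c j)).
  rewrite exchange_big /=; apply: eq_bigr => i _.
  rewrite BC// bilinear_suml// mulr_sumr; apply: eq_bigr => j _.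
  by rewrite BC//; ring.
by move=> j _; rewrite !mxE mulr_suml; apply: eq_bigr => i _; rewrite !mxE.
Qed.

Lemma quadraticD x y : S x -> S y -> B x y = 0 ->
  B (x + y) (x + y) = B x x + B y y.
Proof.
move=> Sx Sy xy0.
have BDl u v w : S u -> S v -> S w -> B (u + v) w = B u w + B v w.
  by move=> Su Sv Sw; rewrite -[u]scale1r BPl// mul1r scale1r.
have Sxy : S (x + y) by rewrite -[x]scale1r; apply: subS.2.
rewrite BDl// [B x _]BC// [B y _]BC// !BDl// [B y x]BC// xy0.
by rewrite addr0 add0r.
Qed.

Context (S1 S2 : set V).
Hypothesis subS1 : linear_subspace S1.
Hypothesis subS2 : linear_subspace S2.
Hypothesis S1S : S1 `<=` S.
Hypothesis S2S : S2 `<=` S.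
Hypothesis S12 : forall x y, S1 x -> S2 y -> B x y = 0.
Hypothesis S1D2 : forall x, S x -> exists2 y, S2 y & S1 (x - y).

Let neg_def_dims (U : set V) : set nat :=
  [set k : nat | exists f : 'I_k -> V, (forall c : 'I_k -> R, U (\sum_i c i *: f i)) /\
     (forall c : 'I_k -> R, (exists i, c i != 0) ->
        B (\sum_i c i *: f i) (\sum_i c i *: f i) < 0)].

(** A negative definite family in [S1] followed by one in [S2] is negative definite in [S], since
    orthogonality removes the cross terms. The suprema are then taken one index at a time. *)
Lemma neg_index_orthogonal_ge : (neg_index S1 B + neg_index S2 B <= neg_index S B)%E.
Proof.
have key k1 k2 :
    neg_def_dims S1 k1 -> neg_def_dims S2 k2 ->
    ((k1%:R)%:E + (k2%:R)%:E <= neg_index S B)%E.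
  move=> [f [Sf Bf]] [g [Sg Bg]].
  apply: ereal_sup_ubound; exists (k1 + k2)%N; last by rewrite natrD EFinD.
  pose h i := match fintype.split i with inl j => f j | inr j => g j end.
  have hE c : \sum_i c i *: h i = \sum_i c (lshift k2 i) *: f i + \sum_i c (rshift k1 i) *: g i.
    rewrite big_split_ord /=; congr +%R; apply: eq_bigr => i _.
      by rewrite /h (unsplitK (inl i)).
    by rewrite /h (unsplitK (inr i)).
  exists h; split => [c|c [i ci]]; rewrite hE.
    by rewrite -[X in S (X + _)]scale1r; apply: subS.2; [exact: S1S|exact: S2S].
  (* A nonzero coefficient is guaranteed on one side only. On the other the combination may be 0,
     and [B 0 0 = 0] because 0 lies in both [S1] and [S2]. *)
  have le0 k (e : 'I_k -> V) (d : 'I_k -> R) :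
      ((exists i, d i != 0) -> B (\sum_i d i *: e i) (\sum_i d i *: e i) < 0) ->
      B (\sum_i d i *: e i) (\sum_i d i *: e i) <= 0.
    have [/existsP d0 /(_ d0)/ltW//|] := boolP [exists i, d i != 0].
    rewrite negb_exists => /forallP d0 _.
    rewrite big1 => [|l _]; last by have := d0 l; rewrite negbK => /eqP ->; rewrite scale0r.
    by rewrite S12//; [exact: subS1.1|exact: subS2.1].
  rewrite quadraticD; [|exact: S1S|exact: S2S|exact: S12].
  rewrite -[i]splitK in ci; case: (fintype.split i) ci => j /= cj.
    by rewrite -[ltRHS]addr0; apply: ltr_leD; [apply: Bf; exists j|apply: le0; exact: Bg].
  by rewrite -[ltRHS]addr0; apply: ler_ltD; [apply: le0; exact: Bf|apply: Bg; exists j].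
have n1 := neg_index_ge0 S1 B subS1.1.
have n2 := neg_index_ge0 S2 B subS2.1.
have key1 k1 : neg_def_dims S1 k1 ->
    ((k1%:R)%:E + neg_index S2 B <= neg_index S B)%E.
  move=> k1P; rewrite addeC -leeBrDr//; apply: ge_ereal_sup => _ [k2 k2P <-].
  by rewrite leeBrDr// addeC; exact: key.
(* Moving the index of [S2] across the inequality requires it to be finite; if it is infinite, the
   case [k1 = 0] already forces the index of [S] to be infinite. *)
have [n2y|n2fin] := eqVneq (neg_index S2 B) +oo%E.
  have /key1 : neg_def_dims S1 0%N.
    by exists (fun=> 0); split => [c|c [[]]//]; rewrite big_ord0; exact: subS1.1.
  by rewrite add0e n2y leye_eq => /eqP ->; exact: leey.
have n2f : neg_index S2 B \is a fin_num.
  by rewrite ge0_fin_numE// lt_neqAle n2fin leey.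
by rewrite -leeBrDr//; apply: ge_ereal_sup => _ [k1 k1P <-]; rewrite leeBrDr// key1.
Qed.

(* Given a [k]-dimensional negative definite space spanned by [f], decompose
   [f i = (f i - y i) + y i] along [S1 + S2] and split the form induced on the
   coefficients by the [y i]: where it is negative definite the [y i] span a negative
   definite space, and where it is nonnegative the [f i - y i] do. *)
Lemma neg_index_orthogonal_le : (neg_index S B <= neg_index S1 B + neg_index S2 B)%E.
Proof.
apply: ge_ereal_sup => _ [k [f [Sf Bf]] <-].
have Sfi i : S (f i) by rewrite -(sum_delta _ f i).
have /choice[y] : forall i, exists y, S2 y /\ S1 (f i - y).
  by move=> i; have [y] := S1D2 _ (Sfi i); exists y.
move=> /all_and2[S2y S1fy].
pose F := \matrix_(i, j) B (y i) (y j).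
have Fsym : F^T = F.
  by apply/matrixP => i j; rewrite !mxE BC//; exact: S2S.
have [b [m [N [Z [kbm Zfree Nneg Zpos]]]]] := symmetric_form_split F Fsym.
have combM p q (g : 'I_q -> V) (A : 'M[R]_(p, q)) (c : 'I_p -> R) :
    \sum_i c i *: (\sum_j A i j *: g j) = \sum_j (\row_i c i *m A) 0 j *: g j.
  under eq_bigr do rewrite scaler_sumr.
  rewrite exchange_big /=; apply: eq_bigr => j _.
  rewrite mxE scaler_suml; apply: eq_bigr => i _.
  by rewrite scalerA mxE.
have row_neq0 p (c : 'I_p -> R) i : c i != 0 -> \row_i c i != 0.
  by apply: contra_neq => /rowP/(_ i); rewrite !mxE.
have rowK p (u : 'rV[R]_p) : \row_i u 0 i = u by apply/rowP => i; rewrite mxE.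
(* The [m] rows of [Z] serve [S1] and the [b] rows of [N] serve [S2]. *)
apply: (@le_trans _ _ ((m%:R)%:E + (b%:R)%:E)%E).
  by rewrite -EFinD lee_fin -natrD ler_nat addnC.
apply: leeD; apply: ereal_sup_ubound.
- exists m => //; exists (fun i => \sum_j Z i j *: (f j - y j)).
  split => [c|c [i ci]]; rewrite combM; set d := _ *m Z.
    exact: linear_subspace_sum.
  set x1 := \sum_j _.
  pose x2 := \sum_j d 0 j *: y j.
  have x12 : x1 + x2 = \sum_j d 0 j *: f j.
    by rewrite -big_split /=; apply: eq_bigr => j _; rewrite -scalerDr subrK.
  have S1x : S1 x1 by exact: linear_subspace_sum.
  have S2x : S2 x2 by exact: linear_subspace_sum.
  have d0 : d != 0.
    apply: contra_neq (row_neq0 _ _ _ ci) => d0.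
    by apply: (row_free_inj Zfree); rewrite mul0mx.
  (* This value is [B x1 x1 + B x2 x2], and the choice of [Z] makes the second summand nonnegative,
     so the first must be negative. *)
  have : B (x1 + x2) (x1 + x2) < 0.
    rewrite x12; apply: Bf; apply/existsP; apply: contraNT d0.
    rewrite negb_exists => /forallP d0; apply/eqP/rowP => j.
    by rewrite [RHS]mxE; have := d0 j; rewrite negbK => /eqP.
  rewrite quadraticD; [|exact: S1S|exact: S2S|exact: S12].
  have : 0 <= B x2 x2.
    rewrite bilinear_sum; last by move=> j; exact: S2S.
    by rewrite rowK; exact: Zpos.
  lra.
- exists b => //; exists (fun i => \sum_j N i j *: y j).
  split => [c|c [i ci]]; rewrite combM.
    exact: linear_subspace_sum.
  rewrite bilinear_sum; last by move=> j; exact: S2S.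
  by rewrite rowK; apply: Nneg; exact: row_neq0 ci.
Qed.

Lemma neg_index_orthogonal : neg_index S B = (neg_index S1 B + neg_index S2 B)%E.
Proof.
by apply/eqP; rewrite eq_le neg_index_orthogonal_le neg_index_orthogonal_ge.
Qed.

End neg_index_orthogonal.

(** * Integration on [0,1]: integrability, Fubini on a triangle, integration by parts *)

Section unit_interval.
Context {R : realType}.
Notation mu := (@lebesgue_measure R).
Notation I := (@I01 R).

Lemma measurable_I01 : measurable I.
Proof. exact: measurable_itv. Qed.

#[local] Hint Extern 0 (measurable (@I01 _)) => exact: measurable_I01 : core.

Lemma integrable_continuous_I01 (f : R -> R) :
  {within I, continuous f} -> mu.-integrable I (EFin \o f).
Proof. by apply: continuous_compact_integrable; exact: segment_compact. Qed.

Lemma bounded_continuous_I01 (f : R -> R) :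
  {within I, continuous f} -> [bounded f x | x in I].
Proof.
move=> cf; have /compact_bounded[M [Mr MP]] := continuous_compact cf (@segment_compact _ 0 1).
by exists M; split => // y /MP h x Ix; apply: h; exists x.
Qed.

Lemma measurable_continuous_I01 (f : R -> R) :
  {within I, continuous f} -> measurable_fun I f.
Proof. by apply: subspace_continuous_measurable_fun; exact: measurable_I01. Qed.

Lemma integrableM_continuous_I01 (w h : R -> R) : mu.-integrable I (EFin \o w) ->
  {within I, continuous h} -> mu.-integrable I (fun s => (w s * h s)%:E).
Proof.
move=> iw ch.
apply: (integrableMl _ iw).
- exact: measurable_I01.
- exact: measurable_continuous_I01.
- exact: bounded_continuous_I01.
Qed.

Lemma within_continuousM_I01 (f g : R -> R) :
  {within I, continuous f} -> {within I, continuous g} ->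
  {within I, continuous (fun t => f t * g t)}.
Proof. by move=> cf cg x; apply: cvgM; [exact: cf|exact: cg]. Qed.

Lemma within_continuous_sum_I01 k (f : 'I_k -> R -> R) :
  (forall i, {within I, continuous f i}) ->
  {within I, continuous (fun t => \sum_i f i t)}.
Proof.
move=> cf; elim: k f cf => [|k IH] f cf.
  under eq_fun do rewrite big_ord0.
  by move=> x; exact: cvg_cst.
under eq_fun do rewrite big_ord_recl.
by move=> x; apply: cvgD; [exact: cf|exact: IH].
Qed.

Lemma Rintegral_is_derive (h dh : R -> R) (s t : R) : 0 <= s <= t -> t <= 1 ->
  (forall r : R, is_derive r (1 : R) h (dh r)) -> {within I, continuous dh} ->
  Rintegral mu `[s, t] dh = h t - h s.
Proof.
(* The degenerate interval [s = t] is treated apart, since [continuous_FTC2] is applied with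
   [s < t]. *)
move=> /andP[s0]; rewrite le_eqVlt => /predU1P[-> _ _ _|st t1 hd cdh].
  by rewrite set_itv1 Rintegral_set1 subrr.
have hc (r : R) : {for r, continuous h}.
  apply: differentiable_continuous; rewrite -derivable1_diffP.
  by have := hd r => -[].
rewrite /Rintegral (@continuous_FTC2 _ dh h s t)//.
- apply: continuous_subspaceW cdh => x /=; rewrite /I01 /= !in_itv /= => /andP[sx xt].
  by rewrite (le_trans s0 sx) (le_trans xt t1).
- split => [x _||]; first by have := hd x => -[].
  + exact: cvg_at_right_filter (hc s).
  + exact: cvg_at_left_filter (hc t).
- by move=> x _; rewrite derive1E; have := hd x => -[].
Qed.

(** The product is dominated by [f^2 + g^2]; its measurability comes from that of [f] and [g]. *)
Lemma integrableM_of_sqr (f g : R -> R) :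
  mu.-integrable I (EFin \o f) -> mu.-integrable I (EFin \o g) ->
  mu.-integrable I (fun s => (f s ^+ 2)%:E) ->
  mu.-integrable I (fun s => (g s ^+ 2)%:E) ->
  mu.-integrable I (fun s => (f s * g s)%:E).
Proof.
move=> /measurable_int/measurable_EFinP mf /measurable_int/measurable_EFinP mg if2 ig2.
apply: (@le_integrable _ _ _ mu I _ _ (fun s => (f s ^+ 2)%:E + (g s ^+ 2)%:E)%E).
- exact: measurable_I01.
- by apply/measurable_EFinP; exact: measurable_funM.
- move=> x _; rewrite -EFinD /= lee_fin normrM.
  rewrite [leRHS]ger0_norm ?addr_ge0 ?sqr_ge0//.
  rewrite -(real_normK (num_real (f x))) -(real_normK (num_real (g x))).
  have := sqr_ge0 (`|f x| - `|g x|); have := sqr_ge0 (`|f x| + `|g x|).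
  nra.
- by apply: integrableD => //; exact: measurable_I01.
Qed.

Lemma integrableD_I01 (f g : R -> R) :
  mu.-integrable I (EFin \o f) -> mu.-integrable I (EFin \o g) ->
  mu.-integrable I (fun t => (f t + g t)%:E).
Proof. by move=> fi gi; exact: (integrableD _ fi gi). Qed.

Lemma integrableZ_I01 (a : R) (f : R -> R) :
  mu.-integrable I (EFin \o f) -> mu.-integrable I (fun t => (a * f t)%:E).
Proof. by move=> fi; exact: (integrableZl _ a fi). Qed.

Lemma integrable_sum_I01 k (f : 'I_k -> R -> R) :
  (forall i, mu.-integrable I (EFin \o f i)) ->
  mu.-integrable I (fun t => (\sum_i f i t)%:E).
Proof.
elim: k f => [|k IH] f fi.
  by under eq_fun do rewrite big_ord0; exact: integrable0.
under eq_fun do rewrite big_ord_recl.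
by apply: integrableD_I01; [exact: fi|exact: IH].
Qed.

Lemma Rintegral_sum_I01 k (f : 'I_k -> R -> R) :
  (forall i, mu.-integrable I (EFin \o f i)) ->
  Rintegral mu I (fun t => \sum_i f i t) = \sum_i Rintegral mu I (f i).
Proof.
elim: k f => [|k IH] f fi.
  under eq_Rintegral do rewrite big_ord0.
  by rewrite Rintegral_cst ?mul0r ?big_ord0//.
under eq_Rintegral do rewrite big_ord_recl.
rewrite big_ord_recl RintegralD ?IH//.
exact: integrable_sum_I01.
Qed.

(* Fubini on the triangle [{0 <= s <= t <= 1}]. *)
Lemma Rintegral_triangle (w k : R -> R) :
  mu.-integrable I (EFin \o w) -> mu.-integrable I (EFin \o k) ->
  Rintegral mu I (fun s => w s * Rintegral mu `[s, 1] k) =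
  Rintegral mu I (fun t => Rintegral mu `[0, t] w * k t).
Proof.
move=> iw ik.
(* Extension by zero moves the problem to the whole plane, where the indicator of [D] cuts out the
   triangle. *)
pose w0 := w \_ I; pose k0 := k \_ I.
have iw0 : mu.-integrable setT (EFin \o w0).
  by rewrite /w0 -restrict_EFin -integrable_mkcond//; exact: measurable_I01.
have ik0 : mu.-integrable setT (EFin \o k0).
  by rewrite /k0 -restrict_EFin -integrable_mkcond//; exact: measurable_I01.
pose D : set (measurableTypeR R * measurableTypeR R) := [set p | p.1 <= p.2].
pose f (p : measurableTypeR R * measurableTypeR R) : \bar R :=
  (w0 p.1 * k0 p.2 * \1_D p)%:E.
have mD : measurable D.
  have : measurable_fun setT (fun p : measurableTypeR R * measurableTypeR R => p.1 <= p.2).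
    exact: measurable_fun_ler.
  by move=> /(_ measurableT [set true]); rewrite setTI; exact.
have mf : measurable_fun setT f.
  apply/measurable_EFinP; apply: measurable_funM => //.
  apply: measurable_funM.
  - apply: (measurableT_comp (f := w0)) => //.
    by have /measurable_int/measurable_EFinP := iw0.
  - apply: (measurableT_comp (f := k0)) => //.
    by have /measurable_int/measurable_EFinP := ik0.
have fi : (mu \x mu)%E.-integrable setT f.
  apply/(integrable12ltyP mu mu mf).
  pose K := (\int[mu]_y `|(k0 y)%:E|)%E.
  have [mw0 w0oo] := integrableP _ _ _ iw0.
  have [mk0 k0oo] := integrableP _ _ _ ik0.
  have maw0 : measurable_fun setT (fun x : measurableTypeR R => `|(w0 x)%:E|%E).
    exact: measurableT_comp.
  have mak0 : measurable_fun setT (fun x : measurableTypeR R => `|(k0 x)%:E|%E).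
    exact: measurableT_comp.
  have K0 : (0 <= K)%E by exact: integral_ge0.
  (* The indicator is at most 1, so [f] is dominated by [|w0 x| |k0 y|], whose iterated integral is
     a product of two finite L^1 norms. *)
  apply: (@le_lt_trans _ _ (\int[mu]_x (`|(w0 x)%:E| * K))%E); last first.
    rewrite ge0_integralZr//.
    apply: lte_mul_pinfty => //; first exact: integral_ge0.
    by rewrite ge0_fin_numE//; exact: integral_ge0.
  apply: ge0_le_integral => //.
  - by move=> x _; exact: integral_ge0.
  - by apply: (measurable_fun_fubini_tonelli_F (abse \o f)) => //=; exact: measurableT_comp.
  - by apply: emeasurable_funM => //; exact: measurable_cst.
  - move=> x _; rewrite /K -ge0_integralZl//.
    apply: ge0_le_integral => //.
    + apply: measurableT_comp => //.
      exact: (measurableT_comp mf (measurable_pair1 x)).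
    + by apply: emeasurable_funM => //; exact: measurable_cst.
    + move=> y _; rewrite /f !abse_EFin -EFinM lee_fin /= !normrM ler_piMr ?mulr_ge0//.
      by rewrite indicE; case: (_ \in _); rewrite ?normr1 ?normr0.
have := Fubini fi.
have sub1 s : I s -> `[s, 1] `<=` I.
  by rewrite /I01 /= in_itv/= => /andP[s0 _]; apply: subset_itvr; rewrite bnd_simp.
have sub2 s : I s -> `[0, s] `<=` I.
  by rewrite /I01 /= in_itv/= => /andP[_ s1]; apply: subset_itvl; rewrite bnd_simp.
have patch_integral (A : set R) (h : R -> R) a :
    measurable A -> A `<=` I -> mu.-integrable I (EFin \o h) ->
    (\int[mu]_y (a * (h \_ A) y)%:E = (a * Rintegral mu A h)%:E)%E.
  move=> mA AI ih.
  have ihA : mu.-integrable A (EFin \o h).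
    by apply: integrableS ih => //; exact: measurable_I01.
  have ihAT : mu.-integrable setT (EFin \o (h \_ A)).
    by rewrite -restrict_EFin -integrable_mkcond.
  under eq_integral do rewrite EFinM.
  rewrite integralZl// EFinM; congr *%E.
  rewrite /Rintegral fineK; last exact: integrable_fin_num.
  rewrite [RHS]integral_mkcond; apply: eq_integral => y _.
  by rewrite restrict_EFin.
(* For [x] in [I], the points [y] of [I] with [x <= y] form [[x, 1]]; [fE2] is the mirror
   computation with [[0, y]]. *)
have fE1 x : (\int[mu]_y f (x, y) = (((fun s => w s * Rintegral mu `[s, 1] k) \_ I) x)%:E)%E.
  rewrite patchE; case: ifPn => [/set_mem Ix|nIx]; last first.
    rewrite integral0_eq// => y _.
    by rewrite /f /= /w0 patchE (negbTE nIx) !mul0r.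
  rewrite -patch_integral//; last exact: sub1.
  apply: eq_integral => y _; rewrite /f /w0 /k0 /= !patchE mem_set// -mulrA.
  congr ((_ * _)%:E); rewrite indicE; move: Ix; rewrite /I01 /= in_itv/= => /andP[x0 x1].
  have [xy|yx] := boolP (x <= y).
    rewrite [_ \in D]mem_set// mulr1.
    have -> : (y \in `[0%R, 1%R]%classic) = (y \in `[x, 1]%classic); last by [].
    by apply/idP/idP; rewrite !inE/= !in_itv/= xy ?(le_trans x0 xy).
  rewrite [_ \in D]memNset/D/=; last by apply/negP.
  by rewrite mulr0 memNset//= in_itv/= (negbTE yx).
have fE2 y : (\int[mu]_x f (x, y) = (((fun t => Rintegral mu `[0, t] w * k t) \_ I) y)%:E)%E.
  rewrite patchE; case: ifPn => [/set_mem Iy|nIy]; last first.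
    rewrite integral0_eq// => x _.
    by rewrite /f /= /k0 patchE (negbTE nIy) mulr0 mul0r.
  rewrite [_ * k y]mulrC -patch_integral//; last exact: sub2.
  apply: eq_integral => x _; rewrite /f /w0 /k0 /= !patchE (mem_set Iy).
  rewrite [_ * k y]mulrC -mulrA.
  congr ((_ * _)%:E); rewrite indicE; move: Iy; rewrite /I01 /= in_itv/= => /andP[y0 y1].
  have [xy|yx] := boolP (x <= y).
    rewrite [_ \in D]mem_set// mulr1.
    have -> : (x \in `[0%R, 1%R]%classic) = (x \in `[0, y]%classic); last by [].
    by apply/idP/idP; rewrite !inE/= !in_itv/= xy ?(le_trans xy y1) andbT.
  rewrite [_ \in D]memNset/D/=; last by apply/negP.
  by rewrite mulr0 memNset//= in_itv/= (negbTE yx) andbF.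
under eq_integral do rewrite fE1.
under [in RHS]eq_integral do rewrite fE2.
by move=> e; rewrite [LHS]Rintegral_mkcond [RHS]Rintegral_mkcond; congr fine.
Qed.

(* The primitive of an integrable function need not be differentiable everywhere, so
   the library's integration by parts does not apply to [v]. *)
Lemma Rintegration_by_parts_H1 (v w h dh : R -> R) :
  mu.-integrable I (EFin \o w) ->
  (forall t, I t -> v t = v 0 + Rintegral mu `[0, t] w) ->
  (forall r : R, is_derive r (1 : R) h (dh r)) -> {within I, continuous dh} ->
  Rintegral mu I (fun t => w t * h t + v t * dh t) = v 1 * h 1 - v 0 * h 0.
Proof.
move=> iw vE hd cdh.
have I0 : I 0 by rewrite /I01 /= in_itv/= lexx ler01.
have I1 : I 1 by rewrite /I01 /= in_itv/= lexx ler01.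
have idh := integrable_continuous_I01 _ cdh.
have ch : {within I, continuous h}.
  apply: derivable_within_continuous => x _; by have := hd x => -[].
pose W t := Rintegral mu `[0, t] w.
have cW : {within I, continuous W} by exact: parameterized_integral_continuous.
have iwh := integrableM_continuous_I01 _ _ iw ch.
have iWdh : mu.-integrable I (fun s => (W s * dh s)%:E).
  by apply: integrable_continuous_I01; exact: within_continuousM_I01.
have iw1 : mu.-integrable I (EFin \o (fun s => w s * h 1)).
  by apply: integrableM_continuous_I01 => // x; exact: cvg_cst.
have iv0dh : mu.-integrable I (EFin \o (fun s => v 0 * dh s)).
  by apply: integrable_continuous_I01; apply: within_continuousM_I01 => // x; exact: cvg_cst.
have triangle := Rintegral_triangle _ _ iw idh.
(* Substitute [v = v 0 + W]. The triangle identity then turns the integral of [W dh] into that of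
   [w (h 1 - h)], and the [w h] terms cancel. *)
have -> : Rintegral mu I (fun t => w t * h t + v t * dh t) =
    Rintegral mu I (fun t => (w t * h t + W t * dh t) + v 0 * dh t).
  by apply: eq_Rintegral => t /set_mem It; rewrite (vE t It) /W; ring.
rewrite RintegralD//; last exact: integrableD_I01.
rewrite RintegralD// RintegralZl//.
rewrite -[Rintegral mu I (fun t => W t * dh t)]triangle.
have -> : Rintegral mu I (fun s => w s * Rintegral mu `[s, 1] dh) =
    Rintegral mu I (fun s => w s * h 1 - w s * h s).
  apply: eq_Rintegral => s /set_mem; rewrite /I01 /= in_itv/= => /andP[s0 s1].
  by rewrite (Rintegral_is_derive h) ?s0//; ring.
rewrite RintegralB// RintegralZr// (Rintegral_is_derive h) ?lexx ?ler01//.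
rewrite (vE 1 I1) /I01; ring.
Qed.

End unit_interval.

(** * Coordinates of derivatives of matrix-valued curves *)

Lemma is_derive_mx_coord {R : realType} {m n : nat} (f : R -> 'M[R]_(m, n))
    (df : 'M[R]_(m, n)) (t : R) i j :
  is_derive t (1 : R) f df -> is_derive t (1 : R) (fun r => f r i j) (df i j).
Proof.
case=> /derivable_mxP fd <-.
apply: DeriveDef; first exact: fd.
by rewrite derive_mx ?mxE//; apply/derivable_mxP.
Qed.

Lemma is_derive_mulmxr_coord {R : realType} {n p : nat} (G : 'M[R]_(n, p))
    (f : R -> 'rV[R]_n) (df : 'rV[R]_n) (t : R) j :
  is_derive t (1 : R) f df -> is_derive t (1 : R) (fun r => (f r *m G) 0 j) ((df *m G) 0 j).
Proof.
move=> fd.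
have -> : (fun r => (f r *m G) 0 j) = \sum_i (G i j \*: (fun r => f r 0 i)).
  apply/funext => r; rewrite fct_sumE mxE; apply: eq_bigr => i _ /=.
  by rewrite mulrC.
rewrite mxE (eq_bigr (fun i => G i j *: df 0 i)); last first.
  by move=> i _; rewrite mulrC.
apply: is_derive_sum => i; apply: is_deriveZ.
exact: is_derive_mx_coord.
Qed.

(** * The space H^1: continuity and linearity *)

Section H1_theory.
Context {R : realType} {n : nat}.
Notation mu := (@lebesgue_measure R).
Notation I := (@I01 R).
Implicit Types x y z : HT R n.

(** On [I] each coordinate is a constant plus the primitive of an integrable function. *)
Lemma H1_within_continuous x i : H1 x -> {within I, continuous (fun t => x.1 t 0 i)}.
Proof.
move=> [x2i [_ xE]].
apply: (subspace_eq_continuous (f := fun t => x.1 0 0 i +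
  parameterized_integral mu 0 t (fun s => x.2 s 0 i))).
  by move=> t /set_mem It; rewrite [RHS]xE.
move=> t; apply: cvgD; first exact: cvg_cst.
have := @parameterized_integral_continuous R 0 1 (fun s => x.2 s 0 i) ler01 (x2i i); exact.
Qed.

Lemma H1_linear_subspace : linear_subspace (@H1 R n).
Proof.
split.
  have z2 (s : R) i : (0 : HT R n).2 s 0 i = 0 by rewrite mxE.
  split=> [i|]; last split => [i|t It i].
  - under eq_fun do rewrite z2; exact: integrable0.
  - under eq_fun do rewrite z2 expr0n; exact: integrable0.
  - under eq_Rintegral do rewrite z2.
    by rewrite Rintegral_cst// mul0r addr0 !mxE.
move=> a x y [x2i [x2ii xE]] [y2i [y2ii yE]]; split => [i|]; last split => [i|t It i].
- under eq_fun do rewrite !mxE.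
  exact: (integrableD_I01 _ _ (integrableZ_I01 a _ (x2i i)) (y2i i)).
(* The square is expanded so that its cross term falls under [integrableM_of_sqr]. *)
- have e (s : R) : ((a *: x + y).2 s 0 i ^+ 2)%:E = (a ^+ 2 * x.2 s 0 i ^+ 2 +
      (2 * a * (x.2 s 0 i * y.2 s 0 i) + y.2 s 0 i ^+ 2))%:E.
    by rewrite !mxE; congr EFin; ring.
  under eq_fun do rewrite e.
  apply: (integrableD_I01 _ _ (integrableZ_I01 _ _ (x2ii i))).
  exact: (integrableD_I01 _ _ (integrableZ_I01 _ _
    (integrableM_of_sqr _ _ (x2i i) (y2i i) (x2ii i) (y2ii i))) (y2ii i)).
- have sub : `[0, t] `<=` I.
    by move: It; rewrite /I01 /= in_itv/= => /andP[_ t1]; apply: subset_itvl; rewrite bnd_simp.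
  rewrite !mxE (xE _ It) (yE _ It).
  under [in RHS]eq_Rintegral do rewrite !mxE.
  rewrite RintegralD//; last 2 first.
  + by apply: integrableS (integrableZ_I01 a _ (x2i i)) => //; exact: measurable_I01.
  + by apply: integrableS (y2i i) => //; exact: measurable_I01.
  rewrite RintegralZl//; last by apply: integrableS (x2i i) => //; exact: measurable_I01.
  ring.
Qed.

End H1_theory.

(** * The index form: bilinearity, symmetry, and its values against Jacobi fields *)

Section index_form.
Context {R : realType} {n : nat}.
Notation mu := (@lebesgue_measure R).
Notation I := (@I01 R).
Implicit Types x y z : HT R n.
Variables (G : 'M[R]_n) (Rm : R -> 'M[R]_n) (SP SQ : 'M[R]_n).
Hypothesis hRc : forall i j, {within I, continuous (fun t => Rm t i j)}.

Let density x y (t : R) := gform G (x.2 t) (y.2 t) + gform G (x.1 t *m Rm t) (y.1 t).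

Lemma within_continuous_mulmx_coord (f : R -> 'rV[R]_n) (A : R -> 'M[R]_n) :
  (forall i, {within I, continuous (fun t => f t 0 i)}) ->
  (forall i j, {within I, continuous (fun t => A t i j)}) ->
  forall j, {within I, continuous (fun t => (f t *m A t) 0 j)}.
Proof.
move=> cf cA j; under eq_fun do rewrite mxE.
by apply: within_continuous_sum_I01 => i; exact: within_continuousM_I01.
Qed.

(** The derivative term is a finite sum of products of square integrable functions, and the term in
    [Rm] is continuous. *)
Lemma integrable_Iform_density x y : H1 x -> H1 y -> mu.-integrable I (EFin \o density x y).
Proof.
move=> Hx Hy; apply: integrableD_I01; under eq_fun do rewrite gformE.
  have e (t : R) i : (x.2 t *m G) 0 i * y.2 t 0 i = \sum_j G j i * (x.2 t 0 j * y.2 t 0 i).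
    by rewrite mxE mulr_suml; apply: eq_bigr => j _; ring.
  under eq_fun do under eq_bigr do rewrite e.
  apply: integrable_sum_I01 => i; apply: integrable_sum_I01 => j.
  case: Hx Hy => [x2 [x22 _]] [y2 [y22 _]].
  exact: (integrableZ_I01 _ _ (integrableM_of_sqr _ _ (x2 j) (y2 i) (x22 j) (y22 i))).
apply: integrable_continuous_I01; apply: within_continuous_sum_I01 => i.
apply: within_continuousM_I01; last exact: H1_within_continuous.
apply: (within_continuous_mulmx_coord _ (fun=> G)).
  apply: within_continuous_mulmx_coord => // j; exact: H1_within_continuous.
by move=> k l t; exact: cvg_cst.
Qed.

Lemma IformPl a x y z : H1 x -> H1 y -> H1 z ->
  Iform G Rm SP SQ (a *: x + y) z = a * Iform G Rm SP SQ x z + Iform G Rm SP SQ y z.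
Proof.
move=> Hx Hy Hz; rewrite /Iform.
have ix := integrable_Iform_density _ _ Hx Hz.
have iy := integrable_Iform_density _ _ Hy Hz.
have -> : Rintegral mu I (density (a *: x + y) z) =
    a * Rintegral mu I (density x z) + Rintegral mu I (density y z).
  rewrite -RintegralZl//; last exact: measurable_I01.
  rewrite -RintegralD//; [|exact: measurable_I01|exact: (integrableZ_I01 _ _ ix)].
  apply: eq_Rintegral => t _; rewrite /density.
  have -> : (a *: x + y).1 t *m Rm t = a *: (x.1 t *m Rm t) + y.1 t *m Rm t.
    by rewrite mulmxDl scalemxAl.
  rewrite gformPl [gform G (_ + _) _]gformPl; ring.
have e s S : gform G ((a *: x + y).1 s *m S) (z.1 s) =
    a * gform G (x.1 s *m S) (z.1 s) + gform G (y.1 s *m S) (z.1 s).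
  by rewrite -gformPl mulmxDl scalemxAl.
rewrite !e /density; ring.
Qed.

(** The endpoint conditions enter because [SP] and [SQ] are symmetric only on [P] and [Q]. *)
Lemma IformC (P Q : 'M[R]_n) x y : G^T = G ->
  (forall t, I t -> forall v w, gform G (v *m Rm t) w = gform G v (w *m Rm t)) ->
  (forall v w : 'rV[R]_n, (v <= P)%MS -> (w <= P)%MS ->
            gform G (v *m SP) w = gform G v (w *m SP)) ->
  (forall v w : 'rV[R]_n, (v <= Q)%MS -> (w <= Q)%MS ->
            gform G (v *m SQ) w = gform G v (w *m SQ)) ->
  H1PQ P Q x -> H1PQ P Q y -> Iform G Rm SP SQ x y = Iform G Rm SP SQ y x.
Proof.
move=> Gsym hRs hSPs hSQs [_ [x0 x1]] [_ [y0 y1]]; rewrite /Iform.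
rewrite hSQs// hSPs// ![gform G _ (_ *m _)]gformC//; congr (_ + _ - _).
apply: eq_Rintegral => t /set_mem It.
by rewrite hRs// [gform G (x.1 t) _]gformC// [gform G (x.2 t) _]gformC.
Qed.

(** [dJ] is differentiable, hence continuous, so it and its square are integrable on [I] and the
    fundamental theorem recovers [J]. *)
Lemma jacobi_H1 (J dJ : R -> 'rV[R]_n) : jacobi Rm J dJ -> H1 (J, dJ).
Proof.
move=> [Jd [ddJ [dJd _]]].
have cdJ i : {within I, continuous (fun t => dJ t 0 i)}.
  apply: derivable_within_continuous => t _.
  by case: (is_derive_mx_coord _ _ _ 0 i (dJd t)).
split => [i|]; last split => [i|t It i].
- exact: integrable_continuous_I01.
- by under eq_fun do rewrite expr2; apply: integrable_continuous_I01; exact: within_continuousM_I01.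
- have /andP[t0 t1] : 0 <= t <= 1 by move: It; rewrite /I01 /= in_itv.
  have Jdi (r : R) := is_derive_mx_coord _ _ _ 0 i (Jd r).
  by rewrite /= (Rintegral_is_derive (fun s => J s 0 i)) ?lexx// subrKC.
Qed.

(** By the Jacobi equation and the symmetry of [Rm], the integrand is formally the derivative of
    [g(x, J')]. Integrating by parts in each coordinate leaves only boundary terms. *)
Lemma Iform_jacobi x (J dJ : R -> 'rV[R]_n) : G^T = G ->
  (forall t, I t -> forall v w, gform G (v *m Rm t) w = gform G v (w *m Rm t)) ->
  H1 x -> jacobi Rm J dJ ->
  Iform G Rm SP SQ x (J, dJ) =
  gform G (x.1 1 *m SQ) (J 1) + gform G (x.1 1) (dJ 1)
  - (gform G (x.1 0 *m SP) (J 0) + gform G (x.1 0) (dJ 0)).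
Proof.
move=> Gsym hRs Hx JJ; have HJ := jacobi_H1 _ _ JJ.
case: JJ => Jd [ddJ [dJd ddJE]].
have gE v w : gform G v w = \sum_i v 0 i * (w *m G) 0 i.
  by rewrite gformC// gformE; apply: eq_bigr => i _; rewrite mulrC.
pose f i (t : R) := x.2 t 0 i * (dJ t *m G) 0 i + x.1 t 0 i * (ddJ t *m G) 0 i.
(* [ddJ] is given merely as a derivative; its continuity on [I] comes from the equation
   [ddJ = J Rm]. *)
have cddJ i : {within I, continuous (fun t => (ddJ t *m G) 0 i)}.
  apply: (within_continuous_mulmx_coord _ (fun=> G)); last by move=> k l t; exact: cvg_cst.
  move=> j; apply: (subspace_eq_continuous (f := fun t => (J t *m Rm t) 0 j)).
    by move=> t /set_mem It; rewrite /from_subspace ddJE.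
  by apply: within_continuous_mulmx_coord => // k; exact: (H1_within_continuous _ _ HJ).
have fE i : Rintegral mu I (f i) =
    x.1 1 0 i * (dJ 1 *m G) 0 i - x.1 0 0 i * (dJ 0 *m G) 0 i.
  case: Hx => x2 [_ xE].
  apply: (Rintegration_by_parts_H1 (fun t => x.1 t 0 i) (fun t => x.2 t 0 i)
    (fun t => (dJ t *m G) 0 i) (fun t => (ddJ t *m G) 0 i)) => //.
  + exact: x2.
  + by move=> t It; exact: xE.
  + by move=> t; exact: is_derive_mulmxr_coord.
have fi i : mu.-integrable I (EFin \o f i).
  apply: integrableD_I01.
    apply: integrableM_continuous_I01; first by case: Hx => x2 _; exact: x2.
    apply: derivable_within_continuous => t _.
    by case: (is_derive_mulmxr_coord G _ _ _ i (dJd t)).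
  apply: integrable_continuous_I01; apply: within_continuousM_I01 => //.
  exact: H1_within_continuous.
rewrite /Iform.
have -> : Rintegral mu I (density x (J, dJ)) = \sum_i Rintegral mu I (f i).
  rewrite -Rintegral_sum_I01//; apply: eq_Rintegral => t /set_mem It.
  by rewrite /density /= hRs// -ddJE// !gE -big_split.
rewrite (eq_bigr _ (fun i _ => fE i)) sumrB -!gE /=; ring.
Qed.

End index_form.

(** * The three spaces of fields as linear subspaces, and their inclusions *)

Section spaces.
Context {R : realType} {n : nat}.
Notation mu := (@lebesgue_measure R).
Notation I := (@I01 R).
Implicit Types x y z : HT R n.
Variables (G : 'M[R]_n) (Rm : R -> 'M[R]_n) (P SP Q : 'M[R]_n) (Y dY : R -> 'rV[R]_n).

(** On a Jacobi field this is the constant C_J; it is linear in [x], so its vanishing cuts out a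
    subspace. *)
Let conserved x (t : R) := gform G (x.2 t) (Y t) - gform G (x.1 t) (dY t).

Lemma conservedPl a x y t : conserved (a *: x + y) t = a * conserved x t + conserved y t.
Proof. by rewrite /conserved !gformPl; ring. Qed.

Lemma conserved0 t : conserved 0 t = 0.
Proof. by rewrite /conserved !gform0l subrr. Qed.

(** The exceptional null sets of [x] and [y] have a null union. *)
Lemma ae_conservedPl a x y :
  {ae mu, forall t, I t -> conserved x t = 0} ->
  {ae mu, forall t, I t -> conserved y t = 0} ->
  {ae mu, forall t, I t -> conserved (a *: x + y) t = 0}.
Proof.
apply: filterS2; first exact: (ae_filter_ringOfSetsType mu).
by move=> t x0 y0 It; rewrite conservedPl x0// y0// mulr0 addr0.
Qed.

Lemma submx_lincomb (S : 'M[R]_n) a (v w : 'rV[R]_n) :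
  (v <= S)%MS -> (w <= S)%MS -> ((a *: v + w)%R <= S)%MS.
Proof. by move=> vS wS; apply: addmx_sub => //; exact: scalemx_sub. Qed.

Lemma HcalPQ_linear_subspace : linear_subspace (HcalPQ G P Q Y dY).
Proof.
split.
  split; first by split; [exact: H1_linear_subspace.1|split; exact: sub0mx].
  by apply: aeW => t _; exact: conserved0.
move=> a x y [[Hx [x0 x1]] xC] [[Hy [y0 y1]] yC]; split; last exact: ae_conservedPl.
by split; [exact: H1_linear_subspace.2|split; exact: submx_lincomb].
Qed.

Lemma HP1_linear_subspace : linear_subspace (HP1 G P Y dY).
Proof.
split.
  split; first by split; [exact: H1_linear_subspace.1|split; [exact: sub0mx|]].
  by apply: aeW => t _; exact: conserved0.
move=> a x y [[Hx [x0 x1]] xC] [[Hy [y0 y1]] yC]; split; last exact: ae_conservedPl.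
split; [exact: H1_linear_subspace.2|split; first exact: submx_lincomb].
by rewrite [LHS](_ : _ = a *: x.1 1 + y.1 1)// x1 y1 scaler0 addr0.
Qed.

Lemma HP1_sub_HcalPQ : HP1 G P Y dY `<=` HcalPQ G P Q Y dY.
Proof.
move=> x [[Hx [x0 x1]] xC]; split => //; split => //; split => //.
by rewrite x1 sub0mx.
Qed.

Lemma jacobi_lincomb a x y : jacobi Rm x.1 x.2 -> jacobi Rm y.1 y.2 ->
  jacobi Rm (a *: x + y).1 (a *: x + y).2.
Proof.
move=> [xd [ddx [dxd ddxE]]] [yd [ddy [dyd ddyE]]]; split.
  by move=> t; apply: is_deriveD; apply: is_deriveZ.
exists (a *: ddx + ddy); split => [t|t It].
  by apply: is_deriveD; apply: is_deriveZ.
rewrite [RHS](_ : _ = (a *: x.1 t + y.1 t) *m Rm t)//.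
by rewrite mulmxDl -scalemxAl -ddxE// -ddyE.
Qed.

Lemma JQ_linear_subspace : linear_subspace (JQ G Rm P SP Q Y dY).
Proof.
split.
  split; last by move=> t _; exact: conserved0.
  split; last exact: sub0mx.
  split; last first.
    split; first exact: sub0mx.
    by move=> v vP; rewrite [X in gform G X](_ : _ = 0) ?gform0l// mul0mx addr0.
  split => [t|]; first exact: is_derive_cst.
  exists (cst 0); split => [t|t It]; first exact: is_derive_cst.
  by rewrite mul0mx.
move=> a x y [[[xJ [x0 xP]] x1] xC] [[[yJ [y0 yP]] y1] yC].
split; last first.
  move=> t It; have := conservedPl a x y t; rewrite /conserved => ->.
  by rewrite xC// yC// mulr0 addr0.
split; last exact: submx_lincomb.
split; first exact: jacobi_lincomb.
split; first exact: submx_lincomb.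
(* The initial condition is linear: regrouped, the pairing with [v] is a combination of two
   vanishing pairings. *)
move=> v vP; rewrite [X in gform G X](_ : _ =
  a *: (x.2 0 + x.1 0 *m SP) + (y.2 0 + y.1 0 *m SP)).
  by rewrite gformPl xP// yP// mulr0 addr0.
rewrite [LHS](_ : _ = a *: x.2 0 + y.2 0 + (a *: x.1 0 + y.1 0) *m SP)//.
by rewrite mulmxDl scalerDr scalemxAl addrACA.
Qed.

Lemma JQ_sub_HcalPQ : JQ G Rm P SP Q Y dY `<=` HcalPQ G P Q Y dY.
Proof.
move=> [J dJ] [[[JJ [J0 _]] J1] JC]; split; last exact: aeW.
by split => //; exact: jacobi_H1 JJ.
Qed.

End spaces.

(** * The index formula on the constrained space with endpoints in P and Q *)

Theorem mainTheorem2 (R : realType) (n : nat) (G : 'M[R]_n)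
  (Rm : R -> 'M[R]_n) (Y dY ddY : R -> 'rV[R]_n) (P SP Q SQ : 'M[R]_n)
  (* g: nondegenerate symmetric bilinear form of index 1 *)
  (hGsym : G^T = G) (hGnd : G \in unitmx)
  (hGind : neg_index [set: 'rV[R]_n] (gform G) = 1%:E)
  (* R continuous on [0,1], each R(t) g-symmetric *)
  (hRc : forall i j, {within (@I01 R), continuous (fun t => Rm t i j)})
  (hRs : forall t, (@I01 R) t -> forall v w, gform G (v *m Rm t) w = gform G v (w *m Rm t))
  (* Y is C^2, timelike, Y'' = R[Y] *)
  (hY1 : forall t : R, is_derive t (1 : R) Y (dY t))
  (hY2 : forall t : R, is_derive t (1 : R) dY (ddY t))
  (hYJ : forall t, (@I01 R) t -> ddY t = Y t *m Rm t)
  (hYt : forall t, (@I01 R) t -> gform G (Y t) (Y t) < 0)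
  (* P g-nondegenerate, S^P : P -> P g-symmetric *)
  (hPnd : forall v : 'rV[R]_n, (v <= P)%MS -> (forall w : 'rV[R]_n, (w <= P)%MS -> gform G v w = 0) -> v = 0)
  (hSP : forall v : 'rV[R]_n, (v <= P)%MS -> (v *m SP <= P)%MS)
  (hSPs : forall v w : 'rV[R]_n, (v <= P)%MS -> (w <= P)%MS ->
            gform G (v *m SP) w = gform G v (w *m SP))
  (* S^Q : Q -> Q g-symmetric *)
  (hSQ : forall v : 'rV[R]_n, (v <= Q)%MS -> (v *m SQ <= Q)%MS)
  (hSQs : forall v w : 'rV[R]_n, (v <= Q)%MS -> (w <= Q)%MS ->
            gform G (v *m SQ) w = gform G v (w *m SQ))
  (* J[1] contains Q *)
  (hJ1 : forall q : 'rV[R]_n, (q <= Q)%MS -> exists J dJ : R -> 'rV[R]_n,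
            PJacobi G Rm P SP J dJ /\ CJ0 G Y dY J dJ /\ J 1 = q) :
  neg_index (HcalPQ G P Q Y dY) (Iform G Rm SP SQ)
  = (neg_index (HP1 G P Y dY) (Iform G Rm SP SQ)
     + neg_index (JQ G Rm P SP Q Y dY) (Iform G Rm SP SQ))%E.
Proof.
apply: neg_index_orthogonal.
- exact: HcalPQ_linear_subspace.
- by move=> a x y z [[Hx _] _] [[Hy _] _] [[Hz _] _]; exact: IformPl.
- by move=> x y [xPQ _] [yPQ _]; exact: (IformC _ _ _ _ P Q).
- exact: HP1_linear_subspace.
- exact: JQ_linear_subspace.
- exact: HP1_sub_HcalPQ.
- exact: JQ_sub_HcalPQ.
- move=> x [J dJ] [[Hx [x0 x1]] _] [[[JJ [J0 JP]] _] _].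
  rewrite Iform_jacobi// x1 mul0mx !gform0l addr0 sub0r.
  (* The terms at 0 combine into [g(J'(0) + SP[J(0)], x(0))], a pairing of a vector orthogonal to
     [P] with one in [P]. *)
  by rewrite hSPs// ![gform G (x.1 0) _]gformC// -gformDl addrC JP// oppr0.
- move=> x [[Hx [x0 x1]] xC].
  (* The field [J] is chosen with the same value at 1 as [x], so that [x - J] vanishes there. *)
  have [J [dJ [[JJ [J0 JP]] [JC J1]]]] := hJ1 _ x1.
  have JQJ : JQ G Rm P SP Q Y dY (J, dJ) by split => //; split => //=; rewrite J1.
  exists (J, dJ) => //.
  have [[HJ [_ _]] aeJ] := JQ_sub_HcalPQ _ _ _ _ _ _ _ _ JQJ.
  (* Writing the difference as [-1 *: J + x] matches the closure condition of [linear_subspace]. *)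
  rewrite -[x - _]addrC -scaleN1r; split; last exact: ae_conservedPl.
  split; first exact: H1_linear_subspace.2.
  split; first exact: submx_lincomb.
  by rewrite [LHS](_ : _ = -1 *: J 1 + x.1 1)// J1 scaleN1r addNr.
Qed.
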